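(* Consider the system, data sets and quantities defined in the context, and suppose that: (1) the system is asymptotically stable; (2) $|d_i(k)|\le \bar d_{0_i}$ for all $k\in\mathbb{Z}$ and all $i$, and $u(k)\in\mathbb{U}$ for all $k\in\mathbb{Z}$ with $\mathbb{U}\subset\mathbb{R}^m$ compact; (3) the system is fully observable and reachable; (4) the model order satisfies $o\ge n$; (5) for any $\beta>0$ there exists $N<\infty$ such that $d_2\big(\mathscr{V}_{i_p},\tilde{\mathscr{V}}_{i_p}^N\big)\le\beta$. Then, for each output index $i\in\{1,\dots,q\}$ and any arbitrarily small $\eta>0$, there exists $N<\infty$ such that $$\left(\bar d_{0_i}-\bar d_i\right)-\eta\;\le\;\lim_{p\to\infty}\underline{\lambda}_{i_p}\;\le\;\left(\bar d_{0_i}-\bar d_i\right).$$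
   Context: System: the discrete-time LTI system $x(k+1)=Ax(k)+Bu(k)$, $z(k)=Cx(k)$, with $x(k)\in\mathbb{R}^n$, $u(k)\in\mathbb{R}^m$, $z(k)\in\mathbb{R}^q$, $k\in\mathbb{Z}$; measured output $y(k)=z(k)+d(k)$ with noise $d(k)\in\mathbb{R}^q$. Subscript $i$ denotes the $i$-th component. $\bar d_{0_i}$ is the true (unknown) bound on $|d_i|$, and $\bar d_i\ge0$ is a user-chosen estimate of it. Regressors: for a horizon $p\in\mathbb{N}$ and model order $o$, $\varphi_{i_p}(k)=[y_i(k),\,y_i(k-1),\dots,y_i(k-o+1),\,u(k+p-1)^T,\dots,u(k)^T,\dots,u(k-o+1)^T]^T\in\mathbb{R}^{o+m(o+p-1)}$. Its noise-free version (with $z_i$ in place of $y_i$) takes values in a compact set $\Psi_{i_{p_o}}$ for all $k$, and $\varphi_{i_p}(k)\in\Phi_{i_p}=\Psi_{i_{p_o}}\oplus\mathbb{D}_{i_p}$ (Minkowski sum), where $\mathbb{D}_{i_p}=\{[d_i^{(1)},\dots,d_i^{(o)},0,\dots,0]^T: |d_i^{(l)}|\le\bar d_{0_i},\ l=1,\dots,o\}$ is the set of all possible noise realizations affecting the output values in the regressor. Data: $\tilde{\mathscr{V}}_{i_p}^N=\{[\tilde\varphi_{i_p}(k)^T,\ \tilde y_{i_p}(k)]^T:\ k=1,\dots,N\}\subset\mathbb{R}^{1+o+m(o+p-1)}$ is the set of $N$ sampled pairs, where $\tilde\cdot$ denotes a measured sample and $\tilde y_{i_p}(k)=\tilde y_i(k+p)$.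 Its continuous counterpart is $\mathscr{V}_{i_p}=\{[\varphi_{i_p}^T,\ y_{i_p}]^T:\ y_{i_p}\in Y_{i_p}(\varphi_{i_p}),\ \varphi_{i_p}\in\Phi_{i_p}\}$, where $Y_{i_p}(\varphi_{i_p})\subset\mathbb{R}$ is the compact set of all possible output values (of $y_i(k+p)$) corresponding to the regressor $\varphi_{i_p}$ and to every possible noise realization $d_i$ with $|d_i|\le\bar d_{0_i}$. The distance is $d_2(\mathscr{V}_{i_p},\tilde{\mathscr{V}}_{i_p}^N)=\max_{v_1\in\mathscr{V}_{i_p}}\min_{v_2\in\tilde{\mathscr{V}}_{i_p}^N}\|v_2-v_1\|_2$. Estimated error bound: $\underline\lambda_{i_p}$ (which depends on $N$) is the optimal value of the linear program $$\underline\lambda_{i_p}=\min_{\theta_{i_p}\in\Omega_p,\ \lambda\in\mathbb{R}^+}\lambda\quad\text{subject to}\quad |\tilde y_{i_p}-\tilde\varphi_{i_p}^T\theta_{i_p}|\le\lambda+\bar d_i\ \ \text{for all } [\tilde\varphi_{i_p}^T,\tilde y_{i_p}]^T\in\tilde{\mathscr{V}}_{i_p}^N,$$ where $\Omega_p$ is a compact approximation of $\mathbb{R}^{o+m(o+p-1)}$ (e.g. the hypercube $\|\theta_{i_p}\|_\infty\le10^{100}$), introduced only so that minima are attained.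
   Formalization: The number of samples N may depend on the horizon p (one N for all p is false); the upper bound is claimed only when the estimate d̄_i ≤ d̄_{0_i} (since λ ≥ 0); Ω_p must contain a sup-norm ball of a sufficiently large radius depending only on the system and o. *)

(* Defs.v *)
From HB Require Import structures.
From mathcomp Require Import all_boot all_order all_algebra.
From mathcomp Require Import all_classical all_reals all_analysis.

Set Implicit Arguments.
Unset Strict Implicit.
Unset Printing Implicit Defensive.

Import Order.TTheory GRing.Theory Num.Theory.
Import numFieldNormedType.Exports.

Local Open Scope classical_set_scope.
Local Open Scope ring_scope.

(* The library norm `|v| on matrices is the sup norm. *)
Definition l2norm (R : realType) (N : nat) (v : 'cV[R]_N) : R :=
  Num.sqrt (\sum_(j < N) v j 0 ^+ 2).

Definition sumset (R : realType) (N : nat) (X Y : set 'cV[R]_N) :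
    set 'cV[R]_N :=
  [set v | exists2 a, X a & exists2 b, Y b & v = a + b].

Section StateSpace.
Variables (R : realType) (n m q : nat).
Variables (A : 'M[R]_n) (B : 'M[R]_(n, m)) (C : 'M[R]_(q, n)).

(* Forward evolutions start at time 0; they are used only for the structural
   properties, whereas the signals of the system live on the whole of int. *)
Definition forward_evolution (u : nat -> 'cV[R]_m) (x : nat -> 'cV[R]_n) :=
  forall k, x k.+1 = A *m x k + B *m u k.

Definition evolution (u : int -> 'cV[R]_m) (x : int -> 'cV[R]_n) :=
  forall k, x (k + 1) = A *m x k + B *m u k.

(* Lyapunov stability and global attractivity of the origin for zero input. *)
Definition asymptotically_stable :=
  (forall e : R, 0 < e -> exists2 r : R, 0 < r &
     forall x, forward_evolution (fun=> 0) x ->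
       l2norm (x 0%N) < r -> forall k, l2norm (x k) < e) /\
  (forall x, forward_evolution (fun=> 0) x ->
     (fun k => l2norm (x k)) @ \oo --> (0 : R)).

Definition reachable :=
  forall xf : 'cV[R]_n, exists u, exists x, exists T : nat,
    [/\ forward_evolution u x, x 0%N = 0 & x T = xf].

Definition observable :=
  forall u x x', forward_evolution u x -> forward_evolution u x' ->
    (forall k, C *m x k = C *m x' k) -> x 0%N = x' 0%N.

End StateSpace.

Section MultiStep.
Variables (R : realType) (n m q : nat).
Variables (A : 'M[R]_n) (B : 'M[R]_(n, m)) (C : 'M[R]_(q, n)).
Variables (U : set 'cV[R]_m) (d0 : 'I_q -> R).

Definition clean_output (x : int -> 'cV[R]_n) (i : 'I_q) (k : int) : R :=
  (C *m x k) i 0.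

Definition measured_output (x : int -> 'cV[R]_n) (d : int -> 'cV[R]_q)
    (i : 'I_q) (k : int) : R :=
  (C *m x k + d k) i 0.

Definition admissible_input (u : int -> 'cV[R]_m) := forall k, U (u k).

Definition admissible_noise (d : int -> 'cV[R]_q) :=
  forall k i, `|d k i 0| <= d0 i.

Definition reg_dim (o p : nat) : nat := (o + (o + p - 1) * m)%N.

(* [y(k); ...; y(k-o+1); u(k+p-1); ...; u(k-o+1)]: mxvec is row-major, so the
   second block stacks the input vectors one after the other. *)
Definition regressor (o p : nat) (y : int -> R) (u : int -> 'cV[R]_m)
    (k : int) : 'cV[R]_(reg_dim o p) :=
  col_mx (\col_(j < o) y (k - j%:Z))
    (mxvec (\matrix_(j < o + p - 1) (u (k + p%:Z - 1 - j%:Z))^T))^T.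

Definition noise_set (o p : nat) (i : 'I_q) : set 'cV[R]_(reg_dim o p) :=
  [set v | exists2 e : 'cV[R]_o, (forall l, `|e l 0| <= d0 i) &
           v = col_mx e 0].

(* In what follows Psi is a set containing the noise-free regressors. *)

(* The values of y_i(k+p) over all the system behaviours whose noise-free
   regressors stay in Psi and whose noisy regressor at time k is phi. *)
Definition output_set (o p : nat) (i : 'I_q) (Psi : set 'cV[R]_(reg_dim o p))
    (phi : 'cV[R]_(reg_dim o p)) : set R :=
  [set y | exists x u d k,
     [/\ evolution A B u x, admissible_input u, admissible_noise d,
         (forall j, Psi (regressor o p (clean_output x i) u j)) &
         regressor o p (measured_output x d i) u k = phi /\
         measured_output x d i (k + p%:Z) = y]].

Definition regressor_set (o p : nat) (i : 'I_q)
    (Psi : set 'cV[R]_(reg_dim o p)) : set 'cV[R]_(reg_dim o p) :=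
  sumset Psi (@noise_set o p i).

Definition pair_set (o p : nat) (i : 'I_q) (Psi : set 'cV[R]_(reg_dim o p)) :
    set 'cV[R]_(reg_dim o p + 1) :=
  [set v | exists phi y, [/\ regressor_set i Psi phi,
                             output_set i Psi phi y & v = col_mx phi y%:M]].

Definition sample_set (o p : nat) (i : 'I_q) (x : int -> 'cV[R]_n)
    (u : int -> 'cV[R]_m) (d : int -> 'cV[R]_q) (N : nat) :
    set 'cV[R]_(reg_dim o p + 1) :=
  [set v | exists2 k : nat, (1 <= k <= N)%N &
     v = col_mx (regressor o p (measured_output x d i) u k%:Z)
                (measured_output x d i (k%:Z + p%:Z))%:M].

End MultiStep.

Arguments sample_set {R n m q} C o p i x u d N _.

(* Extended-real valued, so that the distance to an empty sample set is +oo. *)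
Definition d2 (R : realType) (D : nat) (V W : set 'cV[R]_D) : \bar R :=
  ereal_sup [set ereal_inf [set (l2norm (w - v))%:E | w in W] | v in V].

(* Optimal value of the linear program in (theta, lam).  It is nonnegative, and
   it is attained whenever Omega is compact and nonempty and W is finite. *)
Definition error_bound (R : realType) (D : nat) (Omega : set 'cV[R]_D)
    (W : set 'cV[R]_(D + 1)) (dbar : R) : R :=
  inf [set lam | 0 <= lam /\ exists2 theta, Omega theta &
         forall v, W v ->
           `|dsubmx v 0 0 - ((usubmx v)^T *m theta) 0 0| <= lam + dbar].

(* Main.v *)
Require Import Defs.
From HB Require Import structures.
From mathcomp Require Import all_boot all_order all_algebra.
From mathcomp Require Import all_classical all_reals all_analysis.
From mathcomp Require Import zify ring lra.

Set Implicit Arguments.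
Unset Strict Implicit.
Unset Printing Implicit Defensive.

Import Order.TTheory GRing.Theory Num.Theory.
Import numFieldNormedType.Exports.

Local Open Scope classical_set_scope.
Local Open Scope ring_scope.

(** The optimal values lam p of the linear programs converge to
    max(0, d0 i - dbar i) as soon as the number N p of samples used at horizon
    p is large enough, so all the required inequalities can be read off the
    limit.  The limit is obtained by squeezing.

    Upper bound.  Iterating the state equation over the L = o + p - 1 steps
    covered by the inputs in the regressor expresses y(k+p) as
      sum_(j < L) C A^j B u(k+p-1-j) + C A^L x(k+1-o) + d(k+p).
    The first term is linear in the regressor: its coefficients are the Markov
    parameters C A^j B, and the past outputs get coefficient zero.  With this
    choice of theta (markov_predictor) the prediction error is at most d0 i
    plus the size of the free response C A^L x(k+1-o), whatever the samples
    (markov_predictor_residual).  Stability gives A^L -> 0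
    (asymptotically_stable_power_cvg0), and the state is bounded on every
    forward half-line (evolution_bounded), so the free response vanishes
    uniformly in k >= 1 as p grows.  Stability also bounds the Markov
    parameters independently of the horizon, whence the radius rho.

    Lower bound.  No theta predicts better than the noise level: y(k+p) is
    affected by the noise at time k+p, which does not enter the regressor, so
    the same regressor is compatible with the outputs z + d0 i and z - d0 i,
    and one of the two is at distance at least d0 i from the prediction
    (pair_set_residual_ge).  The samples approximate the whole set of pairs
    and the residual is Lipschitz in the pair, uniformly for theta in the
    bounded set Omega p; hence finitely many samples already force an error
    d0 i - e for every such theta at once (sample_residual_ge). *)

(** * Sup-norm estimates for matrices *)

Lemma mx_coord_le (R : realType) (m n : nat) (M : 'M[R]_(m, n)) i j :
  `|M i j| <= `|M|.
Proof.
by rewrite [leRHS]mx_normrE (le_bigmax 0 (fun ij => `|M ij.1 ij.2|) (i, j)).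
Qed.

Lemma mx_norm_le (R : realType) (m n : nat) (M : 'M[R]_(m, n)) (c : R) :
  0 <= c -> (forall i j, `|M i j| <= c) -> `|M| <= c.
Proof.
by move=> c0 Mc; rewrite [leLHS]mx_normrE; apply: bigmax_le => // ij _;
  exact: Mc.
Qed.

Lemma mulmx_norm_le (R : realType) (m n p : nat) (M : 'M[R]_(m, n))
    (N : 'M[R]_(n, p)) : `|M *m N| <= n%:R * `|M| * `|N|.
Proof.
apply: mx_norm_le => [|i j]; first by rewrite !mulr_ge0.
rewrite mxE (le_trans (ler_norm_sum _ _ _))//.
have -> : n%:R * `|M| * `|N| = \sum_(k < n) `|M| * `|N|.
  by rewrite sumr_const card_ord -mulrA mulr_natl.
apply: ler_sum => k _.
by rewrite normrM ler_pM// mx_coord_le.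
Qed.

Lemma mx_norm_le_l2norm (R : realType) (N : nat) (v : 'cV[R]_N) :
  `|v| <= l2norm v.
Proof.
apply: mx_norm_le => [|i j]; first exact: sqrtr_ge0.
rewrite (ord1 j) -sqrtr_sqr ler_wsqrtr// (bigD1 i)//= lerDl sumr_ge0// => k _.
exact: sqr_ge0.
Qed.

(** * Stable evolutions *)

(** Attractivity speaks of single trajectories; applied to the n trajectories
    starting at the basis vectors, which are the columns of the powers of A,
    it controls the whole matrix. *)
Lemma asymptotically_stable_power_cvg0 (R : realType) (n m : nat)
    (A : 'M[R]_n) (B : 'M[R]_(n, m)) :
  asymptotically_stable A B -> (fun k => `|A ^+ k|) @ \oo --> (0 : R).
Proof.
move=> [_ attr].
pose col_evol (j : 'I_n) k := l2norm (A ^+ k *m delta_mx j 0).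
have cvg_col j : col_evol j @ \oo --> (0 : R).
  apply: (attr (fun k => A ^+ k *m delta_mx j 0)) => k.
  by rewrite mulmx0 addr0 exprS mulmxA.
have cvg_sum : (fun k => \sum_(j < n) col_evol j k) @ \oo --> (0 : R).
  rewrite [X in _ --> X](_ : _ = \sum_(j < n) 0); last by rewrite big1.
  by apply: cvg_big => [|j _]; [exact: add_continuous|exact: cvg_col].
apply: (squeeze_cvgr _ (cvg_cst 0) cvg_sum); near=> k.
rewrite normr_ge0/= mx_norm_le//.
  by apply: sumr_ge0 => j _; exact: sqrtr_ge0.
move=> i j; rewrite (bigD1 j)//= -[leLHS]addr0 lerD//; last first.
  by apply: sumr_ge0 => l _; exact: sqrtr_ge0.
have -> : (A ^+ k) i j = (A ^+ k *m delta_mx j (0 : 'I_1)) i 0.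
  by rewrite -colE mxE.
exact: le_trans (mx_coord_le _ _ _) (mx_norm_le_l2norm _).
Unshelve. all: by end_near. Qed.

(** Variation of constants, the inputs being listed from the latest one. *)
Lemma evolution_iter (R : realType) (n m : nat) (A : 'M[R]_n)
    (B : 'M[R]_(n, m)) (u : int -> 'cV[R]_m) (x : int -> 'cV[R]_n) (t : int)
    (k : nat) : evolution A B u x ->
  x (t + k%:Z) = A ^+ k *m x t +
    \sum_(j < k) A ^+ j *m B *m u (t + k%:Z - 1 - j%:Z).
Proof.
have AS l : A *m A ^+ l = A ^+ l.+1 by rewrite exprS.
move=> xP; elim: k => [|k IHk];
  first by rewrite addr0 expr0 mul1mx big_ord0 addr0.
have -> : t + k.+1%:Z = t + k%:Z + 1 by lia.
rewrite xP IHk mulmxDr mulmxA AS mulmx_sumr -addrA big_ord_recl.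
rewrite expr0 mul1mx/= subr0 addrK; congr (_ + _); rewrite addrC; congr (_ + _).
apply: eq_bigr => j _; rewrite !mulmxA AS; congr (_ *m u _).
by rewrite /bump leq0n; lia.
Qed.

Lemma forced_response_bounded (R : realType) (n m : nat) (A : 'M[R]_n)
    (B : 'M[R]_(n, m)) (c : R) (K : nat) : exists2 W : R, 0 <= W &
  forall v : nat -> 'cV[R]_m, (forall j, `|v j| <= c) ->
    `|\sum_(j < K) A ^+ j *m B *m v j| <= W.
Proof.
exists (\sum_(j < K) m%:R * `|A ^+ j *m B| * `|c|).
  by apply: sumr_ge0 => j _; rewrite !mulr_ge0.
move=> v vc; rewrite (le_trans (ler_norm_sum _ _ _))// ler_sum// => j _.
rewrite (le_trans (mulmx_norm_le _ _))// ler_wpM2l//.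
exact: le_trans (vc j) (ler_norm _).
Qed.

(** Some power A^K contracts by a factor 1/2 in the sup norm.  Over a block of K
    steps the state is then at most halved, up to a forced response bounded by
    some W, so a bound that is at least 2 W and at least the first K states
    propagates from block to block. *)
Lemma evolution_bounded (R : realType) (n m : nat) (A : 'M[R]_n)
    (B : 'M[R]_(n, m)) (u : int -> 'cV[R]_m) (x : int -> 'cV[R]_n)
    (c : R) (t : int) :
  (fun k => `|A ^+ k|) @ \oo --> (0 : R) ->
  evolution A B u x -> (forall k, `|u k| <= c) ->
  exists2 M : R, 0 <= M & forall k : nat, `|x (t + k%:Z)| <= M.
Proof.
move=> A0 xP uc.
have [K K0 AK] : exists2 K : nat, (0 < K)%N & n%:R * `|A ^+ K| <= 2^-1.
  have : (fun k => n%:R * `|A ^+ k|) @ \oo --> (0 : R).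
    by rewrite -[X in _ --> X](mulr0 n%:R); exact: cvgMr.
  move=> /cvgrPdist_le /(_ 2^-1)[|N _ NP]; first by rewrite invr_gt0.
  exists N.+1 => //; have := NP N.+1 (leqnSn N).
  by rewrite sub0r normrN ger0_norm ?mulr_ge0.
have [W W0 WP] := forced_response_bounded A B c K.
(* The sum dominates each of the first K states. *)
pose M := \sum_(j < K) `|x (t + j%:Z)| + 2 * W.
have M0 : 0 <= M by rewrite addr_ge0 ?mulr_ge0 ?sumr_ge0.
exists M => // k; elim/ltn_ind: k => k IHk.
have [kK|Kk] := ltnP k K.
  rewrite /M (bigD1 (Ordinal kK))//= -addrA lerDl.
  by rewrite addr_ge0 ?mulr_ge0 ?sumr_ge0.
rewrite -(subnK Kk) PoszD addrA (evolution_iter _ _ xP).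
rewrite (le_trans (ler_normD _ _))//.
have -> : M = 2^-1 * M + 2^-1 * M by rewrite -mulrDl -div1r -splitr mul1r.
apply: lerD.
  rewrite (le_trans (mulmx_norm_le _ _))// ler_pM// ?mulr_ge0//.
  by apply: IHk; rewrite ltn_subrL K0 (leq_trans K0).
apply: le_trans (WP (fun j => u (_ - 1 - j%:Z)) _) _ => //.
by rewrite /M mulrDr mulrA mulVf ?pnatr_eq0// mul1r lerDr mulr_ge0 ?sumr_ge0.
Qed.

(** * The Markov parameters as a multi-step predictor *)

(** Zero weights on the past outputs; on the inputs the impulse response of
    the i-th output, kept at all lags below o + p - 1 and not only below p,
    so that the input part of the regressor is used in full. *)
Definition markov_predictor (R : realType) (n m q : nat) (A : 'M[R]_n)
    (B : 'M[R]_(n, m)) (C : 'M[R]_(q, n)) (o p : nat) (i : 'I_q) :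
    'cV[R]_(reg_dim m o p) :=
  col_mx 0 (mxvec (\matrix_(j < o + p - 1) row i (C *m A ^+ j *m B)))^T.

Lemma mxvec_dot (R : realType) (m n : nat) (X Y : 'M[R]_(m, n)) :
  (mxvec X *m (mxvec Y)^T) 0 0 = \sum_i \sum_j X i j * Y i j.
Proof.
rewrite mxE pair_bigA/= (reindex _ (curry_mxvec_bij _ _))/=.
by apply: eq_bigr => -[i j] _; rewrite mxE !mxvecE.
Qed.

Lemma markov_predictorE (R : realType) (n m q : nat) (A : 'M[R]_n)
    (B : 'M[R]_(n, m)) (C : 'M[R]_(q, n)) (o p : nat) (i : 'I_q)
    (y : int -> R) (u : int -> 'cV[R]_m) (k : int) :
  ((regressor o p y u k)^T *m markov_predictor A B C o p i) 0 0 =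
  (C *m \sum_(j < o + p - 1) A ^+ j *m B *m u (k + p%:Z - 1 - j%:Z)) i 0.
Proof.
rewrite tr_col_mx mul_row_col mulmx0 add0r trmxK mxvec_dot mulmx_sumr summxE.
apply: eq_bigr => j _; rewrite !mulmxA [RHS]mxE.
by apply: eq_bigr => l _; rewrite !mxE mulrC.
Qed.

(** The inputs in the regressor are exactly those acting between the times
    k + 1 - o and k + p, so only the free response from time k + 1 - o and the
    noise on the predicted output remain.  The output sequence y in the
    regressor is arbitrary since its weights are zero. *)
Lemma markov_predictor_residual (R : realType) (n m q : nat) (A : 'M[R]_n)
    (B : 'M[R]_(n, m)) (C : 'M[R]_(q, n)) (o p : nat) (i : 'I_q)
    (x : int -> 'cV[R]_n) (u : int -> 'cV[R]_m) (d : int -> 'cV[R]_q)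
    (y : int -> R) (k : int) : evolution A B u x -> (0 < p)%N ->
  measured_output C x d i (k + p%:Z) -
    ((regressor o p y u k)^T *m markov_predictor A B C o p i) 0 0 =
  (C *m A ^+ (o + p - 1) *m x (k + 1 - o%:Z)) i 0 + d (k + p%:Z) i 0.
Proof.
move=> xP p0; rewrite markov_predictorE /measured_output.
have kE : k + p%:Z = k + 1 - o%:Z + (o + p - 1)%N%:Z.
  by rewrite -subzn ?(leq_trans p0) ?leq_addl// PoszD !addrA; lia.
have -> : x (k + p%:Z) = A ^+ (o + p - 1) *m x (k + 1 - o%:Z) +
    \sum_(j < o + p - 1) A ^+ j *m B *m u (k + p%:Z - 1 - j%:Z).
  by rewrite {1}kE (evolution_iter _ _ xP) -kE.
rewrite mulmxDr mulmxA.
set free := _ *m x _; set forced := C *m \sum_(_ < _) _.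
by rewrite 2![in LHS]mxE addrAC addrK.
Qed.

(** * Prediction errors and the linear program *)

Definition residual (R : realType) (D : nat) (theta : 'cV[R]_D)
    (v : 'cV[R]_(D + 1)) : R :=
  dsubmx v 0 0 - ((usubmx v)^T *m theta) 0 0.

Lemma residual_col (R : realType) (D : nat) (theta phi : 'cV[R]_D) (y : R) :
  residual theta (col_mx phi y%:M) = y - (phi^T *m theta) 0 0.
Proof. by rewrite /residual col_mxKd col_mxKu mxE eqxx mulr1n. Qed.

Lemma residual_lipschitz (R : realType) (D : nat) (theta : 'cV[R]_D)
    (v w : 'cV[R]_(D + 1)) :
  `|residual theta w - residual theta v| <=
  (1 + D%:R * `|theta|) * l2norm (w - v).
Proof.
have -> : residual theta w - residual theta v = residual theta (w - v).
  rewrite /residual !linearB/= mulmxBl !mxE; ring.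
apply: (@le_trans _ _ ((1 + D%:R * `|theta|) * `|w - v|)); last first.
  by rewrite ler_wpM2l ?mx_norm_le_l2norm// addr_ge0 ?mulr_ge0.
move: (w - v) => {}v; rewrite /residual (le_trans (ler_normB _ _))// mulrDl.
rewrite mul1r lerD//; first by rewrite mxE mx_coord_le.
rewrite (le_trans (mx_coord_le _ _ _))// (le_trans (mulmx_norm_le _ _))//.
rewrite mulrAC ler_wpM2l ?mulr_ge0//.
by apply: mx_norm_le => // i j; rewrite !mxE mx_coord_le.
Qed.

(** The gap between b and c is there because the infimum defining the distance
    from v to W need not be attained. *)
Lemma d2_le_ex (R : realType) (D : nat) (V W : set 'cV[R]_D) (b c : R) :
  (d2 V W <= b%:E)%E -> b < c ->
  forall v, V v -> exists2 w, W w & l2norm (w - v) <= c.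
Proof.
move=> VW bc v Vv.
have /ereal_inf_lt[_ [w Ww <-]] :
    (ereal_inf [set (l2norm (w - v))%:E | w in W] < c%:E)%E.
  apply: le_lt_trans (le_trans _ VW) _; last by rewrite lte_fin.
  by apply: ereal_sup_ubound; exists v.
by rewrite lte_fin => /ltW; exists w.
Qed.

Lemma error_bound_le (R : realType) (D : nat) (Omega : set 'cV[R]_D)
    (W : set 'cV[R]_(D + 1)) (dbar c : R) (theta : 'cV[R]_D) :
  Omega theta -> (forall v, W v -> `|residual theta v| <= c) ->
  error_bound Omega W dbar <= Num.max 0 (c - dbar).
Proof.
move=> Ot Wc; apply: ge_inf; first by exists 0 => l [].
split; first by rewrite le_max lexx.
exists theta => // v /Wc/le_trans; apply.
by rewrite -lerBlDr le_max lexx orbT.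
Qed.

(** The bound b on the residuals of one theta makes the program feasible;
    without it the infimum could be that of the empty set, which is 0. *)
Lemma error_bound_ge (R : realType) (D : nat) (Omega : set 'cV[R]_D)
    (W : set 'cV[R]_(D + 1)) (dbar c b : R) (theta : 'cV[R]_D) :
  Omega theta -> (forall v, W v -> `|residual theta v| <= b) ->
  (forall t, Omega t -> exists2 v, W v & c <= `|residual t v|) ->
  Num.max 0 (c - dbar) <= error_bound Omega W dbar.
Proof.
move=> Ot Wb Wc; apply: lb_le_inf.
  exists (Num.max 0 (b - dbar)); split; first by rewrite le_max lexx.
  exists theta => // v /Wb/le_trans; apply.
  by rewrite -lerBlDr le_max lexx orbT.
move=> l [l0 [t /Wc[v Wv cv] /(_ v Wv)/(le_trans cv)]].
by rewrite -lerBlDr ge_max l0.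
Qed.

(** * Lower bound on the prediction errors *)

(** The trajectory (x, u) is kept and the noise is chosen: zero except at time
    p, where it has size d0 and the sign of the noise-free prediction error e
    made from time 0.  As p > 0, time p is not among the times 0, -1, ...,
    1 - o of the outputs in the regressor at time 0, so the regressor and the
    prediction do not see this noise and the error becomes |e| + d0 i. *)
Lemma pair_set_residual_ge (R : realType) (n m q : nat) (A : 'M[R]_n)
    (B : 'M[R]_(n, m)) (C : 'M[R]_(q, n)) (U : set 'cV[R]_m) (d0 : 'I_q -> R)
    (o p : nat) (i : 'I_q) (x : int -> 'cV[R]_n) (u : int -> 'cV[R]_m)
    (Psi : set 'cV[R]_(reg_dim m o p)) (theta : 'cV[R]_(reg_dim m o p)) :
  evolution A B u x -> admissible_input U u -> (forall j, 0 <= d0 j) ->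
  (forall k, Psi (regressor o p (clean_output C x i) u k)) -> (0 < p)%N ->
  exists2 v, pair_set A B C U d0 i Psi v & d0 i <= `|residual theta v|.
Proof.
move=> xP uU d0_ge0 PsiP p0.
pose phi := regressor o p (clean_output C x i) u 0.
pose e := clean_output C x i p%:Z - (phi^T *m theta) 0 0.
pose s : R := if 0 <= e then 1 else -1.
pose d (k : int) : 'cV[R]_q := if k == p%:Z then \col_j (s * d0 j) else 0.
have ds k j : `|d k j 0| <= d0 j.
  rewrite /d; case: ifP => _; rewrite mxE ?normr0//.
  rewrite normrM (ger0_norm (d0_ge0 _)).
  by rewrite /s; case: ifP; rewrite ?normrN normr1 mul1r.
have phiE : regressor o p (measured_output C x d i) u 0 = phi.
  congr col_mx; apply/matrixP => l l'; rewrite !mxE.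
  rewrite /measured_output /clean_output /d.
  have -> : (0 - (l : nat)%:Z == p%:Z) = false by apply/negbTE/eqP; lia.
  by rewrite !mxE addr0.
exists (col_mx phi (measured_output C x d i p%:Z)%:M).
  exists phi, (measured_output C x d i p%:Z); split => //.
    exists phi; first exact: PsiP.
    exists 0; last by rewrite addr0.
    by exists 0; [move=> l; rewrite mxE normr0|rewrite col_mx0].
  by exists x, u, d, 0; rewrite add0r; split.
rewrite residual_col.
have -> : measured_output C x d i p%:Z = clean_output C x i p%:Z + s * d0 i.
  by rewrite [LHS]mxE /d eqxx [X in _ + X]mxE.
rewrite addrAC -/e.
have := d0_ge0 i; rewrite /s; have [e0|e0] := leP 0 e => di0.
  by rewrite mul1r; apply: le_trans (ler_norm _); lra.
by rewrite mulN1r -normrN; apply: le_trans (ler_norm _); lra.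
Qed.

Lemma bounded_set_le (R : realType) (V : normedModType R) (X : set V) :
  bounded_set X -> exists2 c : R, 0 <= c & forall v, X v -> `|v| <= c.
Proof.
by move=> /pinfty_ex_gt0[c c0 Xc]; exists c; [exact: ltW|exact: Xc].
Qed.

(** This bound is the radius rho: any Omega p containing that ball contains the
    predictor, at every horizon and for every output. *)
Lemma markov_predictor_norm_le (R : realType) (n m q : nat) (A : 'M[R]_n)
    (B : 'M[R]_(n, m)) (C : 'M[R]_(q, n)) (Q : R) (o p : nat) (i : 'I_q) :
  (forall k, `|A ^+ k| <= Q) ->
  `|markov_predictor A B C o p i| <= n%:R * (n%:R * `|C| * Q) * `|B|.
Proof.
move=> AQ; have Q0 : 0 <= Q := le_trans (normr_ge0 _) (AQ 0%N).
apply: mx_norm_le => [|a b]; first by rewrite !mulr_ge0.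
rewrite mxE; case: fintype.split => [l|l];
  first by rewrite mxE normr0 !mulr_ge0.
rewrite mxE (ord1 b); case/mxvec_indexP: l => j l; rewrite mxvecE 2!mxE.
rewrite (le_trans (mx_coord_le _ _ _))// (le_trans (mulmx_norm_le _ _))//.
rewrite ler_wpM2r// ler_wpM2l// (le_trans (mulmx_norm_le _ _))//.
by rewrite ler_wpM2l// mulr_ge0.
Qed.

(** A residual |res| >= c at a pair v survives, up to e, at a sample within
    e / (1 + D T) of v, where T bounds Omega: this radius is the same for all
    theta in Omega, so that one N serves them all. *)
Lemma sample_residual_ge (R : realType) (D : nat) (Omega : set 'cV[R]_D)
    (V : set 'cV[R]_(D + 1)) (W : nat -> set 'cV[R]_(D + 1)) (c e : R) :
  bounded_set Omega ->
  (forall t, Omega t -> exists2 v, V v & c <= `|residual t v|) ->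
  (forall b : R, 0 < b -> exists N, (d2 V (W N) <= b%:E)%E) -> 0 < e ->
  exists N, forall t, Omega t -> exists2 w, W N w & c - e <= `|residual t w|.
Proof.
move=> /bounded_set_le[T T0 OT] Vc dVW e0.
have L0 : 0 < 1 + D%:R * T by rewrite ltr_wpDr ?mulr_ge0.
have b0 : 0 < e / (1 + D%:R * T) by rewrite divr_gt0.
have [N dN] := dVW _ (divr_gt0 b0 (ltr0Sn R 1)).
exists N => t Ot; have [v Vv cv] := Vc t Ot.
have [w Ww wv] : exists2 w, W N w & l2norm (w - v) <= e / (1 + D%:R * T).
  by apply: (d2_le_ex dN) Vv; rewrite ltr_pdivrMr// mulr_natr mulr2n ltrDl.
exists w => //; rewrite lerBlDr (le_trans cv)//.
have -> : residual t v = residual t w + (residual t v - residual t w).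
  by rewrite addrC subrK.
rewrite (le_trans (ler_normD _ _))// lerD2l distrC.
rewrite (le_trans (residual_lipschitz _ _ _))//.
apply: (@le_trans _ _ ((1 + D%:R * T) * (e / (1 + D%:R * T)))).
  apply: ler_pM => //; first exact: sqrtr_ge0.
  by rewrite lerD2l ler_wpM2l// OT.
by rewrite mulrC divfK// gt_eqF.
Qed.

(** * Convergence of the estimated error bounds *)

Theorem theorem1 (R : realType) (n m q o : nat)
    (A : 'M[R]_n) (B : 'M[R]_(n, m)) (C : 'M[R]_(q, n))
    (AB_stable : asymptotically_stable A B)
    (ABC_observable : observable A B C)
    (AB_reachable : reachable A B)
    (le_no : (n <= o)%N) :
  exists2 rho : R, 0 <= rho &
  forall (U : set 'cV[R]_m) (d0 dbar : 'I_q -> R)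
    (x : int -> 'cV[R]_n) (u : int -> 'cV[R]_m) (d : int -> 'cV[R]_q)
    (Psi : forall (i : 'I_q) (p : nat), set 'cV[R]_(reg_dim m o p))
    (Omega : forall p : nat, set 'cV[R]_(reg_dim m o p)),
  evolution A B u x ->
  compact U -> admissible_input U u -> admissible_noise d0 d ->
  (forall i, 0 <= dbar i) ->
  (forall i p, (0 < p)%N -> compact (Psi i p)) ->
  (forall i p, (0 < p)%N ->
     forall k, Psi i p (regressor o p (clean_output C x i) u k)) ->
  (forall p, (0 < p)%N -> compact (Omega p)) ->
  (forall p, (0 < p)%N -> [set theta | `|theta| <= rho] `<=` Omega p) ->
  (forall i p, (0 < p)%N -> forall beta : R, 0 < beta -> exists N : nat,
     (d2 (pair_set A B C U d0 i (Psi i p)) (sample_set C o p i x u d N)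
        <= beta%:E)%E) ->
  forall (i : 'I_q) (eta : R), 0 < eta ->
  exists N : nat -> nat,
    let lam p :=
      error_bound (Omega p) (sample_set C o p i x u d (N p)) (dbar i) in
    [/\ cvgn lam,
        (d0 i - dbar i) - eta <= limn lam &
        dbar i <= d0 i -> limn lam <= d0 i - dbar i].
Proof.
have A0 := asymptotically_stable_power_cvg0 AB_stable.
have [Q Q0 AQ] : exists2 Q : R, 0 <= Q & forall k, `|A ^+ k| <= Q.
  have /pinfty_ex_gt0[c c0 Ac] := cvg_seq_bounded (cvgP _ A0).
  by exists c => [|k]; [exact: ltW|rewrite -[leLHS]normr_id; exact: Ac].
exists (n%:R * (n%:R * `|C| * Q) * `|B|); first by rewrite !mulr_ge0.
move=> U d0 dbar x u d Psi Omega xP cU uU dd0 dbar0 cPsi PsiP cO rhoO dV i eta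
  eta0.
have d0_ge0 j : 0 <= d0 j := le_trans (normr_ge0 _) (dd0 0 j).
have [c _ Uc] := bounded_set_le (compact_bounded cU).
have [M M0 xM] := evolution_bounded (2 - o%:Z) A0 xP (fun k => Uc _ (uU k)).
pose eps p := n%:R * (n%:R * `|C| * `|A ^+ (o + p - 1)|) * M.
have eps_cvg : eps @ \oo --> (0 : R).
  rewrite (_ : eps = fun p => (n%:R * n%:R * `|C| * M) * `|A ^+ (o + p - 1)|).
    rewrite -[X in _ --> X](mulr0 (n%:R * n%:R * `|C| * M)); apply: cvgMr.
    rewrite -(cvg_shiftn 1).
    under eq_fun do rewrite addnA addnK addnC.
    by move: A0; rewrite -(cvg_shiftn o).
  by apply/funext => p; rewrite /eps; ring.
have theta_sample p N v : (0 < p)%N -> sample_set C o p i x u d N v ->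
    `|residual (markov_predictor A B C o p i) v| <= d0 i + eps p.
  move=> p0 [k /andP[k0 _] ->]; rewrite residual_col.
  rewrite (markov_predictor_residual _ _ _ _ _ _ xP)//.
  rewrite (le_trans (ler_normD _ _))// [leRHS]addrC lerD//.
  rewrite (le_trans (mx_coord_le _ _ _))// (le_trans (mulmx_norm_le _ _))//.
  apply: ler_pM; rewrite ?mulr_ge0//.
    by rewrite ler_wpM2l// mulmx_norm_le.
  (* The oldest state involved, for the first sample k = 1, is at time 2 - o. *)
  have -> : k%:Z + 1 - o%:Z = 2 - o%:Z + k.-1%:Z by lia.
  exact: xM.
have sampleN p : exists N, (0 < p)%N -> forall t, Omega p t ->
    exists2 w, sample_set C o p i x u d N w &
      d0 i - harmonic p <= `|residual t w|.
  have [->|p0] := posnP p; first by exists 0%N.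
  have [||||N NP] := @sample_residual_ge _ _ (Omega p)
    (pair_set A B C U d0 i (Psi i p)) (sample_set C o p i x u d) (d0 i)
    (harmonic p).
  - exact: compact_bounded (cO _ p0).
  - by move=> t _; apply: pair_set_residual_ge xP _ _ _ _ => //; exact: PsiP.
  - exact: dV.
  - exact: harmonic_gt0.
  by exists N.
(* The sampling loss allowed at horizon p is harmonic p = 1 / (p + 1), so that
   it vanishes in the limit. *)
have [N NP] := choice sampleN.
exists N => lam; set g := d0 i - dbar i.
have lam_cvg : lam @ \oo --> Num.max 0 g.
  apply: (@squeeze_cvgr _ _ _ _ (fun p => Num.max 0 g - harmonic p)
    (fun p => Num.max 0 g + eps p)).
  - near=> p; have p0 : (0 < p)%N by near: p; exact: nbhs_infty_gt.
    have thetaO : Omega p (markov_predictor A B C o p i).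
      by apply: rhoO => //; exact: markov_predictor_norm_le.
    have h0 : 0 < harmonic p :> R by exact: harmonic_gt0.
    have e0 : 0 <= eps p by rewrite !mulr_ge0.
    have theta_res v := theta_sample p (N p) v p0.
    have lo := error_bound_ge (dbar i) thetaO theta_res (NP p p0).
    have hi := error_bound_le (dbar i) thetaO theta_res.
    apply/andP; split.
      apply: le_trans lo; rewrite lerBlDr maxEge/g; case: ifP => _.
        by rewrite -lerBlDr !le_max; apply/orP; left; lra.
      by rewrite -lerBlDr !le_max; apply/orP; right; lra.
    apply: (le_trans hi); rewrite ge_max; apply/andP; split.
      by rewrite addr_ge0// le_max lexx.
    by rewrite addrAC lerD2r le_max lexx orbT.
  - rewrite -[X in _ --> X]subr0.
    by apply: cvgB; [exact: cvg_cst|exact: cvg_harmonic].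
  - by rewrite -[X in _ --> X]addr0; apply: cvgD; [exact: cvg_cst|].
have limE : limn lam = Num.max 0 g by exact: cvg_lim.
split; first exact: cvgP lam_cvg.
  by rewrite limE (@le_trans _ _ g) ?le_max ?lexx ?orbT// gerBl ltW.
by move=> le_dbar; rewrite limE ge_max lexx andbT subr_ge0.
Unshelve. all: by end_near. Qed.
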